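(* Let $n$ be a positive integer and let $\mu$ be a continuous measure on $\mathbb{T}$. Then $\mu$ is $\times n$-invariant if and only if its distribution function $D_\mu$ is $T_n$-invariant.
   Context: $\mathbb{T}$ is the unit circle, identified with $[0,1)$ via $x\mapsto \exp(2\pi i x)$. A measure means a Borel probability measure; it is continuous (non-atomic) if every single point has measure $0$. The measure $\mu$ is $\times n$-invariant if it is invariant under $z\mapsto z^n$ on $\mathbb{T}$ (equivalently $x\mapsto nx \bmod 1$ on $[0,1)$). The distribution function of $\mu$ is $D_\mu(x)=\mu([0,x))$ for $x\in[0,1]$; when $\mu$ is continuous, $D_\mu$ is a continuous function on $[0,1]$. $C[0,1]$ is the space of continuous (complex-valued) functions on $[0,1]$. For a positive integer $n$, the operator $T_n:C[0,1]\to C[0,1]$ is defined by $T_n(g)(x)=\sum_{j=0}^{n-1}\left[g\left(\frac{x+j}{n}\right)-g\left(\frac{j}{n}\right)\right]$ for $g\in C[0,1]$, $x\in[0,1]$. A function $f\in C[0,1]$ is $T_n$-invariant if $T_n(f)=f$. *)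

(* Defs.v *)
From HB Require Import structures.
From mathcomp Require Import all_boot all_order all_algebra complex.
From mathcomp Require Import all_classical all_reals all_analysis.

Set Implicit Arguments.
Unset Strict Implicit.
Unset Printing Implicit Defensive.

Import Order.TTheory GRing.Theory Num.Theory numFieldNormedType.Exports.

Local Open Scope classical_set_scope.
Local Open Scope ring_scope.

(* R[i] has no canonical topology in the library; its alias R[i]^o carries the
   one given by the modulus. *)
Definition circle (R : realType) : Type :=
  set_type [set z : R[i]^o | `|z| = 1].

HB.instance Definition _ (R : realType) := Topological.on (circle R).

Section circle_maps.
Context {R : realType}.
Implicit Types (x : R) (z : circle R) (n : nat).

Lemma circle_norm z : `|val z| = 1.
Proof. by case: z => z /= /set_mem. Qed.

Definition circle_of (z : R[i]^o) (hz : `|z| = 1) : circle R :=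
  exist _ z (mem_set hz).

Lemma norm_expi x : `|(cos x +i* sin x)%C : R[i]^o| = 1.
Proof. by rewrite normc_def /= cos2Dsin2 sqrtr1. Qed.

Lemma norm_pow n z : `|val z ^+ n : R[i]^o| = 1.
Proof. by rewrite normrX circle_norm expr1n. Qed.

(* x |-> exp(2 pi i x), whose restriction to [0, 1[ identifies it with the
   circle *)
Definition circle_exp x : circle R := circle_of (norm_expi (2 * pi * x)).

Definition circle_pow n z : circle R := circle_of (norm_pow n z).

End circle_maps.

HB.instance Definition _ (R : realType) :=
  isPointed.Build (circle R) (circle_exp 0).

Definition borel_circle (R : realType) :=
  g_sigma_algebraType (@open (circle R)).

HB.instance Definition _ (R : realType) := Measurable.on (borel_circle R).

Section measures.
Context {R : realType}.
Implicit Type mu : probability (borel_circle R) R.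

Definition continuous_measure mu := forall z : circle R, mu [set z] = 0%E.

Definition times_invariant (n : nat) mu :=
  forall A : set (borel_circle R), measurable A ->
    mu (circle_pow n @^-1` A) = mu A.

(* Only the values at x in [0, 1] are meaningful. *)
Definition distr_fun mu (x : R) : R[i]^o :=
  (fine (mu (circle_exp @` `[0, x[)))%:C%C.

End measures.

Section operator.
Context {R : realType}.
Implicit Types (n : nat) (g : R -> R[i]^o).

(* C[0, 1], an element being represented by any function on R that restricts
   to it *)
Definition C01 : set (R -> R[i]^o) :=
  [set g : R -> R[i]^o | {within `[0, 1], continuous g}].

Definition T_op n g (x : R) : R[i]^o :=
  \sum_(j < n) (g ((x + j%:R) / n%:R) - g (j%:R / n%:R)).

Lemma T_op_C01 n g : C01 g -> C01 (T_op n g).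
Proof.
move=> /subspace_continuousP cg; apply/subspace_continuousP => x x01.
apply: cvg_big => [|j _]; first exact: add_continuous.
apply: cvgB; last exact: cvg_cst.
have n_gt0 : 0 < n%:R :> R by rewrite ltr0n; case: n j => [[]|].
pose h (y : R) := (y + j%:R) / n%:R.
have h01 y : y \in `[0, 1] -> h y \in `[0, 1].
  rewrite /h !in_itv /= => /andP[y0 y1].
  rewrite divr_ge0 ?addr_ge0 ?ler0n //= ler_pdivrMr// mul1r.
  by rewrite -lerBrDr (le_trans y1)// lerBrDr nat1r ler_nat.
apply: (@cvg_comp _ _ _ h g _ _ _ _ (cg _ (h01 _ x01))) => /=.
have ch : h y @[y --> x] --> h x.
  by apply: cvgM; [apply: cvgD; [exact: cvg_id|exact: cvg_cst]|exact: cvg_cst].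
move=> B /ch /=; rewrite !nbhs_simpl /within /= => nB.
by apply: filterS nB => y yB /h01; exact: yB.
Qed.

Definition T_invariant n g := C01 g /\ {in `[0, 1], T_op n g =1 g}.

End operator.

(* Main.v *)
From HB Require Import structures.
Require Import Defs.
From mathcomp Require Import all_boot all_order all_algebra complex.
From mathcomp Require Import all_classical all_reals all_analysis.
From mathcomp Require Import measurable_realfun ring lra.

(** Let angle : circle -> [0, 1[ be the inverse of x |-> exp(2 pi i x).  On
    [0, 1] the distribution function of mu is D(x) = mu {angle < x}
    [distr_funE], so both sides of the equivalence are about the initial arcs
    {angle < x}.

    The map z |-> z ^ n multiplies angles by n modulo 1.  Hence, for x in
    [0, 1], angle(z ^ n) < x holds exactly when n * angle(z) lies in
    [j, x + j[ for some j < n: the preimage of an initial arc is the disjoint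
    union of the n arcs [j / n, (x + j) / n[ [circle_pow_preimage], whose
    measures are the differences D((x + j) / n) - D(j / n).  The measure of
    this preimage is therefore T_n(D)(x) [T_op_distr_fun], and T_n(D) = D says
    that mu and its image under z |-> z ^ n agree on initial arcs.

    Agreement on initial arcs is agreement on all Borel sets
    [eq_probability_arc]: it gives the laws of angle the same values on the
    rays ]-oo, x[, a pi-system generating the Borel sets of the line, and every
    Borel set A of the circle is the preimage under angle of the Borel set of
    the x such that exp(2 pi i x) is in A.

    Finally D is continuous because mu has no atoms [distr_fun_C01]. *)

Set Implicit Arguments.
Unset Strict Implicit.
Unset Printing Implicit Defensive.

Import Order.TTheory GRing.Theory Num.Theory numFieldNormedType.Exports.

Local Open Scope classical_set_scope.
Local Open Scope ring_scope.

(** * The parametrization of the circle and its inverse *)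

Section angle.
Context {R : realType}.
Implicit Types (t x : R) (z : circle R).

Lemma continuous_real_complex : continuous (fun x : R => x%:C%C : R[i]^o).
Proof.
move=> x; apply/cvgrPdist_lt => -[a b] /=.
rewrite ltcE /= => /andP[/eqP -> a_gt0].
have : \forall y \near x, `|x - y| < a.
  by apply: (@cvgr_dist_lt _ _ _ (nbhs x) _ id x) => //; exact: cvg_id.
apply: filterS => y xya.
by rewrite -rmorphB normc_def/= expr0n/= addr0 sqrtr_sqr ltcR.
Qed.

Lemma circle_expD s t :
  val (circle_exp (s + t)) = val (circle_exp s) * val (circle_exp t).
Proof.
rewrite /= mulrDr cosD sinD; simpc.
by congr (_ +i* _)%C; ring.
Qed.

Lemma circle_exp1 : circle_exp 1 = circle_exp 0 :> circle R.
Proof.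
by apply: val_inj; rewrite /= mulr1 mulr0 mulr_natl cos2pi sin2pi cos0 sin0.
Qed.

Lemma circle_expDnat t m : circle_exp (t + m%:R) = circle_exp t.
Proof.
elim: m => [|m IHm]; first by rewrite addr0.
apply: val_inj; rewrite -natr1 addrA circle_expD IHm circle_exp1.
by rewrite -circle_expD addr0.
Qed.

Lemma circle_pow_exp n t : circle_pow n (circle_exp t) = circle_exp (n%:R * t).
Proof.
apply: val_inj; elim: n => [|n IHn].
  by rewrite mul0r /= mulr0 cos0 sin0 expr0.
by rewrite -[n.+1%:R]natr1 mulrDl mul1r circle_expD -IHn /= exprSr.
Qed.

(** If exp(2 pi i s) = exp(2 pi i t) then cos(2 pi (t - s)) = 1, so by the
    double-angle formula sin(pi (t - s)) = 0, whereas sin is positive on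
    ]0, pi[. *)
Lemma circle_exp_inj : {in `[0, 1[ &, injective (@circle_exp R)}.
Proof.
suff inj s t :
    0 <= s -> s <= t -> t < 1 -> circle_exp s = circle_exp t -> s = t.
  move=> s t /[!in_itv]/= /andP[s0 s1] /andP[t0 t1].
  by case: (leP s t) => [|/ltW] ts E; [exact: inj|exact/esym/inj].
move=> s0 st t1 /(congr1 val) /= [ceq seq].
have cos1 : cos (2 * pi * (t - s)) = 1.
  by rewrite mulrBr cosB -ceq -seq -!expr2 cos2Dsin2.
have : sin (pi * (t - s)) ^+ 2 = 0.
  move: cos1; rewrite -mulrA mulr_natl cos_mulr2n cos2sin2 => c.
  lra.
move/eqP; rewrite sqrf_eq0 => /eqP sin0.
apply/eqP; rewrite eq_le st /= leNgt; apply/negP => lt_st.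
have : 0 < sin (pi * (t - s)); last by rewrite sin0 ltxx.
have pi0 := pi_gt0 R.
apply: sin_gt0_pi; rewrite mulr_gt0 ?subr_gt0//=.
by rewrite gtr_pMr// ; lra.
Qed.

Lemma circle_exp_surj z : exists2 t, t \in `[0, 1[ & circle_exp t = z.
Proof.
have pi0 := pi_gt0 R.
(* The candidates below, acos(a) / 2 pi and 1 - acos(a) / 2 pi according to the
   sign of b, come with a weak bound by 1; an endpoint 1 can be moved to 0. *)
suff [t /andP[t0 t1] tz] : exists2 t, 0 <= t <= 1 & circle_exp t = z.
  have [lt1|] := ltP t 1; first by exists t => //; rewrite in_itv/= t0.
  move=> ge1; exists 0; first by rewrite in_itv/= lexx ltr01.
  by rewrite -circle_exp1 -tz; congr circle_exp; apply: le_anti; rewrite ge1 t1.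
case: z => -[a b] zin.
have : a ^+ 2 + b ^+ 2 = 1.
  have := set_mem zin; rewrite /= normc_def /= => -[].
  move/(congr1 (fun x => x ^+ 2)); rewrite sqr_sqrtr ?expr1n//.
  by rewrite addr_ge0// sqr_ge0.
move=> ab1.
have a11 : -1 <= a <= 1 by apply/andP; split; nra.
have ac0 := acos_ge0 a11; have ac1 := acos_lepi a11.
have sin_ac : sin (acos a) = `|b|.
  by rewrite sin_acos// -ab1 addrAC subrr add0r sqrtr_sqr.
have cos_ac : cos (acos a) = a by rewrite acosK// in_itv.
pose u := acos a / (2 * pi).
have uE : 2 * pi * u = acos a by rewrite /u mulrC divfK// mulf_neq0// ?gt_eqF.
have u01 : 0 <= u <= 1.
  by rewrite ler_pdivlMr ?ler_pdivrMr ?mulr_gt0//; lra.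
have [b0|b0] := leP 0 b.
  exists u => //; apply: val_inj.
  by rewrite /= uE cos_ac sin_ac ger0_norm.
exists (1 - u); first by lra.
apply: val_inj => /=; rewrite mulrBr mulr1 uE cosB sinB mulr_natl cos2pi sin2pi.
by rewrite cos_ac sin_ac ltr0_norm//; congr (_ +i* _)%C; ring.
Qed.

Lemma continuous_circle_exp : continuous (@circle_exp R).
Proof.
have cE : continuous (fun t : R => val (circle_exp t) : R[i]^o).
  have -> : (fun t : R => val (circle_exp t) : R[i]^o) =
      (fun t => (cos (2 * pi * t))%:C%C + 'i%C * (sin (2 * pi * t))%:C%C).
    by apply/funext => t /=; simpc.
  move=> t.
  have lin : 2 * pi * s @[s --> t] --> 2 * pi * t.
    by apply: cvgM; [exact: cvg_cst|exact: cvg_id].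
  have real_comp (f : R -> R) : continuous f ->
      (f (2 * pi * s))%:C%C @[s --> t] --> ((f (2 * pi * t))%:C%C : R[i]^o).
    move=> cf; apply: (@cvg_comp _ _ _ (fun s => f (2 * pi * s))
      (fun x : R => x%:C%C : R[i]^o) _ _ _ _ (@continuous_real_complex _)).
    exact: (cvg_comp _ _ lin (cf _)).
  apply: cvgD; first exact: real_comp (@continuous_cos R).
  apply: cvgM; first exact: cvg_cst.
  exact: real_comp (@continuous_sin R).
apply/continuousP => _ [B oB <-].
by move/continuousP: cE; exact.
Qed.

(** The argument in turns, normalized to [0, 1[. *)
Definition angle z : R := projT1 (cid2 (circle_exp_surj z)).

Lemma angle_itv z : angle z \in `[0, 1[.
Proof. by rewrite /angle; case: cid2. Qed.

Lemma angle_ge0 z : 0 <= angle z.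
Proof. by have /[!in_itv]/andP[] := angle_itv z. Qed.

Lemma angle_lt1 z : angle z < 1.
Proof. by have /[!in_itv]/andP[] := angle_itv z. Qed.

Lemma angleK : cancel angle (@circle_exp R).
Proof. by move=> z; rewrite /angle; case: cid2. Qed.

Lemma circle_expK : {in `[0, 1[, cancel (@circle_exp R) angle}.
Proof.
by move=> t t01; apply: circle_exp_inj; rewrite ?angleK ?angle_itv.
Qed.

Lemma continuous_circle_val : continuous (val : circle R -> R[i]^o).
Proof. by apply/continuousP => B oB; exists B. Qed.

Lemma circle_hausdorff : hausdorff_space (circle R).
Proof.
move=> z w zw; apply/val_inj/(@norm_hausdorff _ R[i]^o) => A B zA wB.
have [u [Au Bu]] :=
  zw _ _ (continuous_circle_val zA) (continuous_circle_val wB).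
by exists (val u).
Qed.

Lemma circle_exp_itv x : x \in `[0, 1] ->
  circle_exp @` `[0, x[ = [set z | angle z < x].
Proof.
rewrite in_itv/= => /andP[x0 x1].
apply/seteqP; split => [_ [t /= tx <-]|z /= zx].
  move: tx; rewrite in_itv/= => /andP[t0 tx].
  by rewrite circle_expK// in_itv/= t0 (lt_le_trans tx).
by exists (angle z); rewrite ?angleK//= in_itv/= angle_ge0.
Qed.

Lemma arc_lt x : [set z | angle z < x] = angle @^-1` `]-oo, x[.
Proof. by apply/seteqP; split => z /=; rewrite in_itv. Qed.

(** The angle jumps at the point 1, but its nonempty sublevel sets are
    images of segments starting at 0, hence compact.  This is what makes it
    measurable. *)
Lemma closed_angle_le x : closed [set z | angle z <= x].
Proof.
have [x0|x0] := ltP x 0.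
  rewrite (_ : [set _ | _] = set0); first exact: closed0.
  by rewrite -subset0 => z /(le_trans (angle_ge0 z)); rewrite leNgt x0.
have -> : [set z | angle z <= x] = circle_exp @` `[0, x].
  apply/seteqP; split => [z /= zx|_ [t /= tx <-]].
    by exists (angle z); rewrite ?angleK//= in_itv/= angle_ge0.
  move: tx; rewrite in_itv/= => /andP[t0 tx].
  have [t1|t1] := ltP t 1; first by rewrite circle_expK// in_itv/= t0.
  exact: le_trans (ltW (angle_lt1 _)) (le_trans t1 tx).
apply: compact_closed; first exact: circle_hausdorff.
apply: continuous_compact; last exact: segment_compact.
by apply: continuous_subspaceT; exact: continuous_circle_exp.
Qed.

End angle.

(** * Random variables without atoms *)

Section no_atoms.
Context d (T : measurableType d) (R : realType) (P : probability T R).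
Variable X : {RV P >-> R}.

(** Right-continuity is that of the cumulative distribution function
    P (X <= x), which equals P (X < x) without atoms; left-continuity follows
    from P (X < x) = P (- X > - x) and the right-continuity of the
    complementary distribution function of - X. *)
Lemma continuous_measure_lt : (forall r, P (X @^-1` [set r]) = 0%E) ->
  continuous (fun x : R => P (X @^-1` `]-oo, x[)).
Proof.
move=> X_na x; apply/left_right_continuousP; split.
  apply/cvg_at_leftNP.
  have mNX : measurable_fun setT (fun t => - X t).
    by apply: measurable_funN; exact: measurable_funP.
  pose NX : {RV P >-> R} := mfun_Sub (mem_set mNX).
  have ccdfE y : P (X @^-1` `]-oo, (- y)[) = ccdf NX y.
    by rewrite /ccdf /distribution /pushforward; congr (P _);
      apply/seteqP; split => t /=; rewrite !in_itv/= andbT ltrNr.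
  have -> : (fun x => P (X @^-1` `]-oo, x[)) \o -%R = ccdf NX.
    by apply/funext => y /=; rewrite ccdfE.
  rewrite -[x in X in _ --> X](opprK x) ccdfE.
  exact: ccdf_right_continuous.
have cdfE y : P (X @^-1` `]-oo, y[) = cdf X y.
  rewrite /cdf /distribution /pushforward -(@setUitv1 _ _ _ _ true)//.
  rewrite preimage_setU measureU//.
  - by rewrite [X in (_ + X)%E]X_na adde0.
  - exact: measurable_funPTI.
  - rewrite -subset0 => t /= []; rewrite in_itv/= => /[swap] ->.
    by rewrite ltxx.
have -> : (fun x => P (X @^-1` `]-oo, x[)) = cdf X by exact/funext.
by rewrite cdfE; exact: cdf_right_continuous.
Qed.

End no_atoms.

(** * Borel sets of the circle *)

Section measurability.
Context {R : realType}.

Lemma measurable_angle :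
  measurable_fun [set: borel_circle R] (angle : borel_circle R -> R).
Proof.
apply: (measurability _ (RGenOInfty.measurableE R)) => _ [_ [x ->] <-].
rewrite setTI (_ : _ @^-1` _ = ~` [set z | angle z <= x]).
  by apply: sub_sigma_algebra; exact/closed_openC/closed_angle_le.
by apply/seteqP; split => z /=; rewrite in_itv/= andbT ltNge => /negP.
Qed.

Lemma measurable_circle_exp :
  measurable_fun [set: R] (circle_exp : R -> borel_circle R).
Proof.
apply: (@measurability _ _ R (borel_circle R) _ _ (@open (circle R)) erefl).
move=> _ [B oB <-].
rewrite setTI; apply: open_measurable.
by move/continuousP: (@continuous_circle_exp R); exact.
Qed.

Definition angle_mfun : {mfun borel_circle R >-> R} :=
  mfun_Sub (mem_set measurable_angle).

(** Reading the power map in angles, as multiplication by n, reduces its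
    measurability to that of the angle. *)
Lemma measurable_circle_pow n : measurable_fun [set: borel_circle R]
  (circle_pow n : borel_circle R -> borel_circle R).
Proof.
rewrite (_ : circle_pow n = circle_exp \o ( *%R n%:R) \o angle).
  apply: measurableT_comp measurable_angle.
  by apply: measurableT_comp measurable_circle_exp _; exact: measurable_funM.
by apply/funext => z /=; rewrite -circle_pow_exp angleK.
Qed.

Definition circle_pow_mfun n : {mfun borel_circle R >-> borel_circle R} :=
  mfun_Sub (mem_set (measurable_circle_pow n)).

(** Both measures give angle the same law, since the rays ]-oo, x[ generate the
    Borel sets of the line; and angle loses no Borel set of the circle, as
    circle_exp is a measurable right inverse. *)
Lemma eq_probability_arc (P Q : probability (borel_circle R) R) :
  (forall x, x \in `[0, 1] ->
    P [set z | angle z < x] = Q [set z | angle z < x]) ->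
  forall A, measurable A -> P A = Q A.
Proof.
move=> PQ A mA.
have PQ_itv x : P (angle @^-1` `]-oo, x[) = Q (angle @^-1` `]-oo, x[).
  rewrite -arc_lt.
  have [x0|x0] := ltP x 0.
    suff -> : [set z : circle R | angle z < x] = set0 by rewrite !measure0.
    rewrite -subset0 => z /= zx.
    by have := lt_trans zx x0; rewrite ltNge angle_ge0.
  have [x1|x1] := ltP 1 x; last by apply: PQ; rewrite in_itv/= x0.
  suff -> : [set z : circle R | angle z < x] = setT.
    by rewrite !probability_setT.
  by rewrite -subTset => z _ /=; exact: lt_trans (angle_lt1 z) x1.
have AE : A = angle @^-1` (circle_exp @^-1` A).
  by apply/seteqP; split => z /=; rewrite angleK.
rewrite AE.
change (distribution P angle_mfun (circle_exp @^-1` A) =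
        distribution Q angle_mfun (circle_exp @^-1` A)).
apply: (@measure_unique _ R R (@RGenInftyO.G R) (fun k => `]-oo, k%:R[%classic)
  (RGenInftyO.measurableE R) _ _ _
  (distribution P angle_mfun) (distribution Q angle_mfun)).
- move=> _ _ [x ->] [y ->]; exists (Num.min x y).
  by apply/seteqP; split => t /=; rewrite !in_itv/= lt_min => /andP.
- by move=> k; exists k%:R.
- rewrite -subTset => t _; exists (Num.trunc `|t|).+1 => //=.
  rewrite in_itv/= (le_lt_trans (ler_norm t))//.
  by have /andP[] := truncn_itv (normr_ge0 t).
- by move=> _ [x ->]; exact: PQ_itv.
- by move=> k; rewrite -ge0_fin_numE// fin_num_measure.
- by rewrite -[X in measurable X]setTI; exact: measurable_circle_exp.
Qed.

End measurability.

(** * The power map and the operator *)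

Section transfer.
Context {R : realType}.
Implicit Types (x : R) (z : circle R) (n : nat).
Implicit Types mu : probability (borel_circle R) R.

Lemma angle_circle_pow n z (j : nat) : j%:R <= n%:R * angle z < j.+1%:R ->
  angle (circle_pow n z) = n%:R * angle z - j%:R.
Proof.
move=> /andP[jz zj]; rewrite -{1}(angleK z) circle_pow_exp.
rewrite -{1}(subrK j%:R (n%:R * angle z)) circle_expDnat circle_expK//.
by rewrite in_itv/= subr_ge0 jz/= ltrBlDr nat1r.
Qed.

(** For z in the preimage, the arc that contains it is given by the integer part
    of n * angle z. *)
Lemma circle_pow_preimage n x : (0 < n)%N -> x \in `[0, 1] ->
  circle_pow n @^-1` [set z | angle z < x] =
  \big[setU/set0]_(j < n) (angle @^-1` `[j%:R / n%:R, (x + j%:R) / n%:R[).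
Proof.
move=> n0 /[!in_itv]/andP[x0 x1].
have nR : 0 < n%:R :> R by rewrite ltr0n.
have itvE (j : nat) z : (angle @^-1` `[j%:R / n%:R, (x + j%:R) / n%:R[) z <->
    j%:R <= n%:R * angle z < x + j%:R.
  by rewrite /= in_itv/= ler_pdivrMr// ltr_pdivlMr// (mulrC (angle z)).
apply/seteqP; split => z /=.
  set j := Num.trunc (n%:R * angle z).
  have jz : j%:R <= n%:R * angle z < j.+1%:R.
    by apply: truncn_itv; rewrite mulr_ge0 ?angle_ge0 ?ltW.
  rewrite (angle_circle_pow jz) ltrBlDr => zx.
  have jn : (j < n)%N.
    rewrite -(ltr_nat R); have /andP[/le_lt_trans + _] := jz; apply.
    by rewrite gtr_pMr// angle_lt1.
  rewrite -bigcup_seq; exists (Ordinal jn); first by rewrite /= mem_index_enum.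
  by apply/itvE; rewrite zx andbT; case/andP: jz.
rewrite -bigcup_seq => -[j _ /itvE/andP[jz zx]].
rewrite (@angle_circle_pow _ _ j) ?ltrBlDr// jz/=.
by rewrite (lt_le_trans zx)// -nat1r lerD2r.
Qed.

Lemma trivIset_arcs n x : (0 < n)%N -> x \in `[0, 1] ->
  trivIset [set: 'I_n]
    (fun j => angle @^-1` `[j%:R / n%:R, (x + j%:R) / n%:R[ : set (circle R)).
Proof.
move=> n0 /[!in_itv]/andP[x0 x1]; apply/trivIsetP => i j _ _.
have nR : 0 < n%:R :> R by rewrite ltr0n.
wlog ij : i j / (i < j)%N.
  by move=> W; rewrite neq_ltn => /orP[] h; [|rewrite setIC]; apply: W => //;
    rewrite neq_ltn h ?orbT.
move=> _; rewrite -subset0 => z [] /=.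
rewrite !in_itv/= => /andP[_ zi] /andP[jz _].
have := le_lt_trans jz zi; rewrite ltr_pM2r ?invr_gt0// ltNge => /negP; apply.
by rewrite (@le_trans _ _ i.+1%:R)// ?ler_nat// -nat1r lerD2r.
Qed.

Lemma measurable_arc a b :
  measurable (angle @^-1` [set` Interval a b] : set (borel_circle R)).
Proof.
rewrite -[X in measurable X]setTI.
exact: measurable_angle (measurable_itv _).
Qed.

Lemma measure_arc mu a b : a <= b ->
  fine (mu (angle @^-1` `[a, b[)) =
  fine (mu [set z | angle z < b]) - fine (mu [set z | angle z < a]).
Proof.
move=> ab; rewrite !arc_lt -fineB ?fin_num_measure//; do ?exact: measurable_arc.
have -> : `[a, b[%classic = `]-oo, b[ `\` `]-oo, a[.
  by apply/seteqP; split => t /=; rewrite !in_itv/=;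
    [move=> /andP[/le_gtF -> ->]|move=> [-> /negP]; rewrite -leNgt => ->].
rewrite (_ : _ @^-1` (_ `\` _) =
  angle @^-1` `]-oo, b[ `\` angle @^-1` `]-oo, a[)//.
rewrite measureD ?setIidr//; do ?exact: measurable_arc.
- by move=> z /=; rewrite !in_itv/= => /lt_le_trans; exact.
- by rewrite -ge0_fin_numE// fin_num_measure//; exact: measurable_arc.
Qed.

Lemma distr_funE mu x : x \in `[0, 1] ->
  distr_fun mu x = (fine (mu [set z | angle z < x]))%:C%C.
Proof. by move=> x01; rewrite /distr_fun circle_exp_itv. Qed.

(** Summing over the n disjoint arcs of the preimage yields term by term the sum
    that defines the operator. *)
Lemma T_op_distr_fun n mu x : (0 < n)%N -> x \in `[0, 1] ->
  T_op n (distr_fun mu) x =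
  (fine (mu (circle_pow n @^-1` [set z | angle z < x])))%:C%C.
Proof.
move=> n0 x01; rewrite circle_pow_preimage// measure_bigsetU_ord//; last first.
- exact: trivIset_arcs.
- by move=> j; exact: measurable_arc.
rewrite -sum_fine; last first.
  by move=> j _; rewrite fin_num_measure//; exact: measurable_arc.
rewrite rmorph_sum; apply: eq_bigr => j _.
move: x01; rewrite in_itv/= => /andP[x0 x1].
have nR : 0 < n%:R :> R by rewrite ltr0n.
have jn : j%:R + 1 <= n%:R :> R by rewrite natr1 ler_nat.
have j0 : 0 <= j%:R :> R by [].
rewrite measure_arc ?rmorphB/=; last by rewrite ler_pM2r ?invr_gt0// lerDr.
by rewrite !distr_funE// in_itv/= ler_pdivlMr// ler_pdivrMr//; lra.
Qed.

Lemma distr_fun_C01 mu : continuous_measure mu -> C01 (distr_fun mu).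
Proof.
move=> mu_cont.
pose F x := (fine (mu [set z | angle z < x]))%:C%C : R[i]^o.
have cF : continuous F.
  move=> x.
  apply: (@cvg_comp _ _ _ (fun x => fine (mu [set z | angle z < x]))
    (fun x : R => x%:C%C : R[i]^o) _ _ _ _ (@continuous_real_complex _ _)).
  apply: fine_cvg; rewrite fineK; last first.
    by rewrite fin_num_measure// arc_lt; exact: measurable_arc.
  rewrite arc_lt; under eq_fun do rewrite arc_lt.
  apply: (@continuous_measure_lt _ _ _ mu angle_mfun) => r.
  (* A fibre of the angle is a point of the circle or is empty. *)
  have [r01|r01] := boolP (r \in `[0, 1[).
    rewrite -(mu_cont (circle_exp r)); congr (mu _).
    apply/seteqP; split => z /=.
      by move=> <-; rewrite angleK.
    by move=> ->; rewrite circle_expK.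
  rewrite (_ : _ @^-1` _ = set0) ?measure0// -subset0 => z /= zr.
  by move: r01; rewrite -zr angle_itv.
apply: (@subspace_eq_continuous _ _ _ F).
  by move=> x /set_mem x01; rewrite /from_subspace distr_funE.
exact: (@continuous_subspaceT _ _ _ F).
Qed.

Lemma times_invariantP n mu : (0 < n)%N -> times_invariant n mu <->
  (forall x, x \in `[0, 1] -> T_op n (distr_fun mu) x = distr_fun mu x).
Proof.
move=> n0; split => [inv x x01|inv A mA].
  rewrite T_op_distr_fun// distr_funE// inv// arc_lt; exact: measurable_arc.
change (distribution mu (circle_pow_mfun n) A = mu A).
apply: eq_probability_arc mA => x x01.
have /(congr1 (@complex.Re R)) := inv x x01.
rewrite T_op_distr_fun// distr_funE//=.
move=> fine_eq; rewrite /distribution /pushforward /=.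
have mx : measurable ([set z | angle z < x] : set (borel_circle R)).
  by rewrite arc_lt; exact: measurable_arc.
have mpx : measurable (circle_pow n @^-1` [set z | angle z < x] :
    set (borel_circle R)).
  by rewrite -[X in measurable X]setTI; exact: measurable_circle_pow.
by rewrite -[LHS]fineK ?fin_num_measure// fine_eq fineK ?fin_num_measure.
Qed.

End transfer.

Theorem proposition4p5 (R : realType) (n : nat) (n_gt0 : (0 < n)%N)
    (mu : probability (borel_circle R) R) (mu_cont : continuous_measure mu) :
  times_invariant n mu <-> T_invariant n (distr_fun mu).
Proof.
split=> [/times_invariantP inv|[_ inv]].
  by split; [exact: distr_fun_C01|exact: inv].
by apply/times_invariantP.
Qed.
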